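(* A finite $2$-group has property $(\hat{s})$ if and only if it is abelian.
   Context: Let $F$ be a fixed algebraically closed field of characteristic $0$. For $A\in GL_n(F)$ let $\sigma(A)\subseteq F$ be its set of eigenvalues. A matrix group $\mathcal{G}\subseteq GL_n(F)$ has property $(s)$ if $\sigma(AB)\subseteq\sigma(A)\sigma(B)=\{\lambda\mu:\lambda\in\sigma(A),\mu\in\sigma(B)\}$ for all $A,B\in\mathcal{G}$. A finite group $G$ has property $(\hat{s})$ if for every subgroup $H\le G$ and every irreducible representation $\varrho:H\to GL_n(F)$ the matrix group $\varrho(H)$ has property $(s)$. *)

(* Defs.v *)
From mathcomp Require Import all_boot all_order all_algebra all_fingroup.
From mathcomp Require Import all_solvable all_character.

Set Implicit Arguments.
Unset Strict Implicit.
Unset Printing Implicit Defensive.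

Import GRing.Theory.
Local Open Scope ring_scope.

(* A matrix group is given by its membership predicate S on 'M[F]_n, since
   {'GL_n[F]} is only available over finite rings. *)
Definition property_s (F : fieldType) (n : nat) (S : 'M[F]_n -> Prop) : Prop :=
  forall A B : 'M[F]_n, S A -> S B ->
  forall nu : F, eigenvalue (A *m B) nu ->
  exists lambda mu : F,
    [/\ eigenvalue A lambda, eigenvalue B mu & nu = lambda * mu].

Definition repr_image (F : fieldType) (gT : finGroupType) (H : {group gT})
    (n : nat) (rho : mx_representation F H n) (A : 'M[F]_n) : Prop :=
  exists2 x : gT, x \in H & A = rho x.

(* mx_irreducible excludes the degree n = 0. *)
Definition property_s_hat (F : fieldType) (gT : finGroupType)
    (G : {group gT}) : Prop :=
  forall H : {group gT}, H \subset G ->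
  forall (n : nat) (rho : mx_representation F H n),
  mx_irreducible rho -> property_s (repr_image rho).

(* Main.v *)
Require Import Defs.
From mathcomp Require Import all_boot all_order all_algebra all_fingroup.
From mathcomp Require Import all_solvable all_character.

Set Implicit Arguments.
Unset Strict Implicit.
Unset Printing Implicit Defensive.

Import GRing.Theory.
Local Open Scope ring_scope.

(** A nonabelian 2-group contains x, y whose commutator z has order 2 and
    commutes with both.  In H = <x, y> the elements z, x^2 and y^2 are central,
    so in an irreducible representation of H that does not kill z they become
    scalars -1, a and b.  Then (yx)^2 = y^2 x^2 z acts as -ab, whereas
    property (s) would force an eigenvalue of yx to be a product of a square
    root of b and a square root of a, whose square is ab. *)

Lemma eigenvalue_scalar_mx (F : fieldType) (n : nat) (a l : F) :
  (0 < n)%N -> eigenvalue (a%:M : 'M_n) l = (l == a).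
Proof.
move=> n_gt0; apply/eigenvalueP/eqP=> [[v] | ->].
  rewrite mul_mx_scalar => /eqP; rewrite -subr_eq0 -scalerBl scaler_eq0 subr_eq0.
  by case/orP=> [/eqP-> | ->].
exists (const_mx 1); first by rewrite mul_mx_scalar.
apply/eqP=> /rowP/(_ (Ordinal n_gt0))/eqP.
by rewrite !mxE oner_eq0.
Qed.

(** An eigenvector of [A] for [l] is one of [A *m A] for [l * l], and a scalar matrix has a single
    eigenvalue. *)
Lemma eigenvalue_sqr (F : fieldType) (n : nat) (A : 'M[F]_n) (a l : F) :
  (0 < n)%N -> A *m A = a%:M -> eigenvalue A l -> l * l = a.
Proof.
move=> n_gt0 A2 /eigenvalueP[v vA nz_v]; apply/eqP.
rewrite -(eigenvalue_scalar_mx _ _ n_gt0); apply/eigenvalueP; exists v => //.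
by rewrite -A2 mulmxA vA -scalemxAl vA scalerA.
Qed.

Lemma eigenvalue_exists (F : closedFieldType) (n : nat) (A : 'M[F]_n) :
  (0 < n)%N -> exists l, eigenvalue A l.
Proof.
move=> n_gt0; have: size (char_poly A) != 1.
  by rewrite size_char_poly eqSS -lt0n.
by case/closed_rootP=> l rl; exists l; rewrite eigenvalue_root_char.
Qed.

Section Representations.

Variables (F : closedFieldType) (gT : finGroupType) (H : {group gT}).

(** Schur's lemma: over a closed field [rho] is absolutely irreducible, so its centraliser consists
    of scalars. *)
Lemma mx_irr_center_scalar (n : nat) (rho : mx_representation F H n) (x : gT) :
  mx_irreducible rho -> x \in 'Z(H)%g -> exists a, rho x = a%:M.
Proof.
move=> irr_rho /setIP[Hx cHx].
have /mx_abs_irr_cent_scalar scal := group_closure_closed_field irr_rho.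
apply/is_scalar_mxP/scal/centgmxP=> y Hy.
by rewrite -!repr_mxM // (centP cHx).
Qed.

(** By Maschke the regular representation is a sum of simple submodules. If [z] acted trivially on
    each of them, it would act trivially on the sum, against faithfulness. *)
Lemma mx_irr_neq1 (z : gT) :
  ([pchar F]^'.-group H)%g -> z \in H -> z != 1%g ->
  exists (n : nat) (rho : mx_representation F H n),
    mx_irreducible rho /\ rho z != 1%:M.
Proof.
move=> charH Hz nt_z; pose aH := regular_repr F H.
have [I U W simU defU _] :=
  dec_mx_reducible_semisimple (mxmodule1 aH) (mx_Maschke_pchar aH charH).
have [i nfix_i] : exists i, z \notin rstab aH (U i).
  apply/existsP; apply: contraR nt_z; rewrite negb_exists => /forallP fixU.
  rewrite -in_set1; apply: (subsetP (regular_mx_faithful F H)).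
  rewrite -sub1set rfix_mx_rstabC ?sub1set //.
  rewrite -defU; apply/sumsmx_subP=> i _.
  by rewrite -rfix_mx_rstabC ?sub1set // -[_ \in _]negbK fixU.
have [modU _ _] := simU i.
exists (\rank (U i)), (submod_repr modU); split.
  exact/(submod_mx_irr modU).
apply: contra nfix_i => /eqP rz1; rewrite -(rker_submod modU).
by apply/rkerP.
Qed.

End Representations.

(** For [x] in the second centre, commutators with [x] are central, so a power of [x] yields the
    same power of the commutator; a suitable power brings its order down to [p]. *)
Lemma nonabelian_pgroup_comm (p : nat) (gT : finGroupType) (G : {group gT}) :
  (p.-group G)%g -> ~~ abelian G ->
  exists x y : gT, [/\ x \in G, y \in G, commute x [~ x, y]%g,
    commute y [~ x, y]%g & #[[~ x, y]%g]%g = p].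
Proof.
move=> pG nabG.
have [x Z2x nZx] : exists2 x, x \in 'Z_2(G)%g & x \notin 'Z(G)%g.
  (* Otherwise the [p]-group [G / 'Z(G)] has trivial centre, hence is trivial, and [G] is
     abelian. *)
  apply/subsetPn; apply: contra nabG => sZ21.
  apply: cyclic_center_factor_abelian; rewrite -ucn1.
  have Z1: 'Z(G / 'Z_1(G))%g = 1%g.
    rewrite -(ucn_central 1 G); apply/trivgP.
    rewrite quotient_sub1 ?normal_norm ?ucn_normalS //=.
    by rewrite -ucn1 in sZ21.
  by rewrite (trivg_center_pgroup (quotient_pgroup _ pG) Z1) cyclic1.
have Gx := subsetP (ucn_sub 2 G) x Z2x.
have [y Gy nt_z] : exists2 y, y \in G & [~ x, y]%g != 1%g.
  apply/exists_inP; apply: contraR nZx; rewrite negb_exists_in => /forall_inP cx.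
  rewrite inE Gx; apply/centP=> y Gy; apply/commgP.
  by rewrite -[_ == _]negbK cx.
set z := [~ x, y]%g in nt_z.
have /setIP[Gz cGz] : z \in 'Z(G)%g.
  by rewrite -ucn1 (subsetP (ucn_comm 1 G)) ?mem_commg.
have cz (u : gT) : u \in G -> commute u z.
  by move=> Gu; apply/commute_sym/(centP cGz).
have [||p_pr p_dv_z _] := @pgroup_pdiv _ p <[z]>%G.
- exact: mem_p_elt pG Gz.
- by rewrite cycle_eq1.
set m := (#[z]%g %/ p)%N; have Exm: [~ (x ^+ m)%g, y]%g = (z ^+ m)%g.
  by rewrite commXg //; apply: cz.
exists (x ^+ m)%g, y; rewrite Exm; split=> //.
- exact: groupX.
- by apply/commuteX/cz/groupX.
- by apply/commuteX/cz.
by rewrite orderXdiv ?dvdn_div // divnA // mulKn.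
Qed.

Theorem corollary3p4 (F : closedFieldType) (charF0 : [pchar F] =i pred0)
    (gT : finGroupType) (G : {group gT}) (pG : (2.-group G)%g) :
  property_s_hat F G <-> abelian G.
Proof.
split=> [sG | cGG H sHG n rho irr_rho _ _ [x Hx ->] [y Hy ->] nu]; last first.
  (* Abelian case: [H] is its own centre, so [rho x] and [rho y] are scalars. *)
  have n_gt0 : (0 < n)%N by case/mx_irrP: irr_rho.
  have ZH : 'Z(H)%g = H by apply/center_idP; apply: abelianS cGG.
  have [] := mx_irr_center_scalar irr_rho (x := x); rewrite ?ZH // => a ->.
  have [] := mx_irr_center_scalar irr_rho (x := y); rewrite ?ZH // => b ->.
  rewrite -scalar_mxM eigenvalue_scalar_mx // => /eqP->.
  by exists a, b; rewrite !eigenvalue_scalar_mx.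
apply: contraT => nabG; exfalso.
have [x [y [Gx Gy cxz cyz oz]]] := nonabelian_pgroup_comm pG nabG.
set z := [~ x, y]%g in cxz cyz oz.
have z2 : (z ^+ 2 = 1)%g by rewrite -oz expg_order.
pose H := <<[set x; y]>>%G.
have Hx : x \in H by rewrite mem_gen ?set21.
have Hy : y \in H by rewrite mem_gen ?set22.
have Hz : z \in H by rewrite groupR.
have sHG : H \subset G by rewrite gen_subG subUset !sub1set Gx.
have ZHI u : u \in H -> commute u x -> commute u y -> u \in 'Z(H)%g.
  move=> Hu cux cuy; rewrite inE Hu /= cent_gen; apply/centP=> v.
  by rewrite !inE => /orP[]/eqP->.
have Zz : z \in 'Z(H)%g by apply: ZHI => //; apply: commute_sym.
have Zx2 : (x ^+ 2)%g \in 'Z(H)%g.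
  apply: ZHI; rewrite ?groupX //; first exact/commute_sym/commuteX.
  (* Here [[~ x ^+ 2, y] = z ^+ 2 = 1]. *)
  by apply/commgP; rewrite commXg ?z2.
have Zy2 : (y ^+ 2)%g \in 'Z(H)%g.
  apply: ZHI; rewrite ?groupX //; last exact/commute_sym/commuteX.
  by apply/commute_sym/commgP; rewrite commgX ?z2.
have charH : ([pchar F]^'.-group H)%g.
  by apply/pgroupP=> q _ _; rewrite inE /= charF0.
have [|n [rho [irr_rho nt_rz]]] := mx_irr_neq1 charH Hz.
  by rewrite -order_eq1 oz.
have n_gt0 : (0 < n)%N by case/mx_irrP: irr_rho.
have [c rz] := mx_irr_center_scalar irr_rho Zz.
have [a rx2] := mx_irr_center_scalar irr_rho Zx2.
have [b ry2] := mx_irr_center_scalar irr_rho Zy2.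
have rsqr u : u \in H -> rho u *m rho u = rho (u ^+ 2)%g.
  by move=> Hu; rewrite -repr_mxM.
have c2 : c * c = 1.
  apply: (eigenvalue_sqr (A := rho z)) => //; first by rewrite rsqr // z2 repr_mx1.
  by rewrite rz eigenvalue_scalar_mx.
have Ec : c = -1.
  move/eqP: c2; rewrite -expr2 sqrf_eq1 => /orP[/eqP c1 | /eqP//].
  by rewrite rz c1 eqxx in nt_rz.
have ryx2 : rho (y * x)%g *m rho (y * x)%g = (- (b * a))%:M.
  have [Hx2 Hy2] := (groupX 2 Hx, groupX 2 Hy).
  (* The exponent of [z] in the expansion of [(y * x) ^+ 2] is the binomial coefficient
     ['C(2, 2) = 1]. *)
  rewrite rsqr ?groupM // expMg_Rmul // expg1.
  rewrite (repr_mxM rho (groupM Hy2 Hx2) Hz) (repr_mxM rho Hy2 Hx2).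
  by rewrite rx2 ry2 rz Ec -!scalar_mxM mulrN1.
have [nu nuP] := eigenvalue_exists (rho (y * x)%g) n_gt0.
have nu2 := eigenvalue_sqr n_gt0 ryx2 nuP.
have [|||m [l [mP lP Enu]]] := sG H sHG n rho irr_rho (rho y) (rho x) _ _ nu.
- by exists y.
- by exists x.
- by rewrite -repr_mxM.
have m2 : m * m = b by apply: eigenvalue_sqr mP; rewrite // rsqr.
have l2 : l * l = a by apply: eigenvalue_sqr lP; rewrite // rsqr.
(* The square of [nu] equals both [b * a] and its opposite, so characteristic 0 forces [nu = 0]; but
   [rho (y * x)] is invertible. *)
have nu0 : nu = 0.
  apply/eqP; rewrite -sqrf_eq0 expr2; apply/eqP.
  have: (nu * nu) *+ 2 = 0.
    by rewrite mulr2n {1}nu2 -m2 -l2 Enu mulrACA addNr.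
  move/eqP; rewrite -mulr_natr mulf_eq0 ((pcharf0P F).1 charF0) orbF.
  by move/eqP.
case/eigenvalueP: nuP => v; rewrite nu0 scale0r => v0 /eqP[].
by rewrite -(repr_mxK rho (groupM Hy Hx) v) v0 mul0mx.
Qed.
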